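(* Let $(\tau,\xi)\in\mathbb{R}^2$ and let $\{f_n\}_{n\in\mathbb{N}_0}\subset\mathrm{F}$ be such that $f_n(\tau,\xi)>0$ for all $n\in\mathbb{N}_0$. Let $\varphi_n\in C^1([\tau,T_n),\mathbb{R})$ denote the unique maximal solution of the initial value problem $x'=f_n(t,x)$, $x(\tau)=\xi$, for each $n\in\mathbb{N}_0$. Then for any values $T\in(\tau,T_0)$ and $X\in(\varphi_0(T),\infty)$, $$\Vert f_0-f_n\Vert_{[\tau,T]\times[\xi,X]}\xrightarrow{n\to\infty}0\ \implies\ \Vert\varphi_0-\varphi_n\Vert_{[\tau,T]}\xrightarrow{n\to\infty}0.$$
   Context: $\mathrm{F}\subset C(\mathbb{R}^2,\mathbb{R})$ is the set of continuous functions $f:\mathbb{R}^2\to\mathbb{R}$, $(t,x)\mapsto f(t,x)$, such that $f(\cdot,x)$ is strictly increasing for every $x\in\mathbb{R}$, and $f(\tau,\xi)>0$ for some $(\tau,\xi)\in\mathbb{R}^2$. A maximal solution of $x'=f(t,x)$, $x(\tau)=\xi$ (going forwards in time) is a path $\varphi\in C^1([\tau,T_* ),\mathbb{R})$ for some $T_*\in(\tau,\infty]$ which verifies $\varphi(\tau)=\xi$, $\varphi'(t)=f(t,\varphi(t))$ for every $t\in[\tau,T_* )$, and $T_*\vee\sup_{t\in[\tau,T_* )}|\varphi(t)|=\infty$. When $f\in\mathrm{F}$ and $f(\tau,\xi)>0$ such a maximal solution exists and is unique. Norms: $\Vert f\Vert_{[\tau,T]\times[\xi,X]}:=\sup\{|f(t,x)|:(t,x)\in[\tau,T]\times[\xi,X]\}$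 and $\Vert\varphi\Vert_{[\tau,T]}:=\sup_{t\in[\tau,T]}|\varphi(t)|$, with the convention that $\Vert\varphi_0-\varphi_n\Vert_{[\tau,T]}:=\infty$ if $T\ge T_n$ (i.e. if $\varphi_n$ is not defined on all of $[\tau,T]$). $\mathbb{N}_0=\{0,1,2,\dots\}$. *)

(* Defs.v *)
From HB Require Import structures.
From mathcomp Require Import all_boot all_order all_algebra.
From mathcomp Require Import all_classical all_reals all_analysis.

Set Implicit Arguments.
Unset Strict Implicit.
Unset Printing Implicit Defensive.

Import Order.TTheory GRing.Theory Num.Theory.
Import numFieldNormedType.Exports.

Local Open Scope classical_set_scope.
Local Open Scope ring_scope.

(* The class F of right-hand sides; a point of R * R is (t, x), time first. *)
Definition rhs_class (R : realType) : set (R * R -> R) :=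
  [set f : R * R -> R | [/\ continuous f,
               forall x : R, {homo (fun t : R => f (t, x)) : s t / s < t} &
               exists tau xi : R, 0 < f (tau, xi)]].

Definition sup_norm (R : realType) (S : Type) (A : set S) (g : S -> R) : \bar R :=
  ereal_sup [set `|g s|%:E | s in A].

(* The interval [tau, Tmax), where Tmax may be +oo. *)
Definition time_dom (R : realType) (tau : R) (Tmax : \bar R) : set R :=
  [set t | tau <= t /\ (t%:E < Tmax)%E].

(* Derivative relative to D: two-sided at interior points of an interval D,
   one-sided at an endpoint belonging to D. *)
Definition has_deriv_within (R : realType) (D : set R) (phi : R -> R)
    (t l : R) : Prop :=
  (phi s - phi t) / (s - t) @[s --> within D t^'] --> l.

Definition C1_within (R : realType) (D : set R) (phi : R -> R) : Prop :=
  exists dphi : R -> R,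
    (forall t, D t -> has_deriv_within D phi t (dphi t)) /\
    {within D, continuous dphi}.

(* A path on [tau, Tmax) is encoded by a total function R -> R, whose values
   outside [tau, Tmax) are irrelevant. *)
Definition is_maximal_solution (R : realType) (f : R * R -> R) (tau xi : R)
    (Tmax : \bar R) (phi : R -> R) : Prop :=
  let D := time_dom tau Tmax in
  [/\ (tau%:E < Tmax)%E,
      C1_within D phi,
      phi tau = xi,
      forall t, D t -> has_deriv_within D phi t (f (t, phi t)) &
      maxe Tmax (sup_norm D phi) = +oo%E].

(* The norm of phi - psi over [tau, T], where psi is a path on [tau, Tpsi);
   by convention it is +oo when psi is not defined on all of [tau, T]. *)
Definition path_dist (R : realType) (tau T : R) (phi : R -> R)
    (Tpsi : \bar R) (psi : R -> R) : \bar R :=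
  if (T%:E < Tpsi)%E then sup_norm `[tau, T] (phi \- psi) else +oo%E.

(* Main.v *)
(** Since [f (., x)] is strictly increasing, the time shift [phi0 (t + h)] of a
    solution is a strict supersolution of the original equation and
    [phi0 (t - h)] a strict subsolution.  By compactness the gap
    [f0 (t + h, x) - f0 (t, x)] is bounded below on the rectangle by some
    [m > 0], so both remain strict for [f_n] as soon as
    [|f0 - f_n| < m] there.  A first-contact argument then gives
    [phi0 (t - h) <= phi_n t <= phi0 (t + h)], and uniform continuity of [phi0]
    concludes.  The bound also prevents [phi_n] from blowing up before [T].
    The same comparison of a solution with its own shift shows that solutions
    are strictly increasing; no local Lipschitz condition is involved. *)
Require Import Defs.
From HB Require Import structures.
From mathcomp Require Import all_boot all_order all_algebra.
From mathcomp Require Import all_classical all_reals all_analysis.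
From mathcomp Require Import ring lra.

Set Implicit Arguments.
Unset Strict Implicit.
Unset Printing Implicit Defensive.

Import Order.TTheory GRing.Theory Num.Theory.
Import numFieldNormedType.Exports.

Local Open Scope classical_set_scope.
Local Open Scope ring_scope.

(** * Left derivatives and the first-contact principle *)

(** A first zero is reached from the left, so the contact argument is phrased with backward
    difference quotients. *)
Definition left_deriv (R : realType) (u : R -> R) (t l : R) : Prop :=
  (u t - u (t - k)) / k @[k --> 0^'+] --> l.

Lemma left_deriv_gt0 (R : realType) (u : R -> R) (t l : R) :
  left_deriv u t l -> 0 < l -> \forall k \near 0^'+, u (t - k) < u t.
Proof.
move=> ul l0; near=> k.
have k0 : 0 < k by near: k; apply: nbhs_right_gt.
have : 0 < (u t - u (t - k)) / k by near: k; exact: (cvgr_gt l ul).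
by rewrite pmulr_lgt0 ?invr_gt0// subr_gt0.
Unshelve. all: by end_near.
Qed.

(** If [u] were nonpositive somewhere, the infimum [c] of such points would satisfy [u c <= 0] by
    continuity, and [u] would already be negative just before [c], against minimality. *)
Lemma gt0_of_left_deriv_gt0_at_zeros (R : realType) (u : R -> R) (a b : R) :
  0 < u a ->
  (forall t, a <= t <= b -> u s @[s --> within `[a, b] (nbhs t)] --> u t) ->
  (forall t, a < t <= b -> u t = 0 -> exists2 l, 0 < l & left_deriv u t l) ->
  forall t, a <= t <= b -> 0 < u t.
Proof.
move=> ua ucont uderiv t /andP[at_ tb]; rewrite ltNge; apply/negP => ut.
pose S : set R := [set s | a <= s <= t /\ u s <= 0].
have S0 : S !=set0 by exists t; split => //; rewrite at_ lexx.
have Sa : has_lbound S by exists a => s [/andP[]].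
have Si : has_inf S by [].
pose c := inf S.
have ac : a <= c by apply: lb_le_inf => // s [/andP[]].
have ct : c <= t by apply: ge_inf => //; split => //; rewrite at_ lexx.
have cab : a <= c <= b by rewrite ac (le_trans ct).
have before s : a <= s -> s < c -> 0 < u s.
  move=> as_ sc; rewrite ltNge; apply/negP => us.
  have : S s by split => //; rewrite as_ (le_trans (ltW sc)).
  by move=> /(ge_inf Sa); rewrite leNgt sc.
have uc_le0 : u c <= 0.
  rewrite leNgt; apply/negP => uc.
  have /nbhs_ballP[e /= e0 He] : \forall s \near c, `[a, b]%classic s -> 0 < u s.
    exact: (cvgr_gt _ (ucont c cab)).
  have [s [/andP[as_ st] us] sce] := inf_adherent e0 Si.
  have cs : c <= s by apply: ge_inf => //; split => //; rewrite as_.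
  have : 0 < u s.
    apply: He; last by rewrite /= in_itv/= as_ (le_trans st).
    by rewrite /ball/= ler0_norm ?subr_le0// opprB ltrBlDl.
  by rewrite ltNge us.
have {}ac : a < c.
  rewrite lt_neqAle ac andbT; apply/eqP => acE; move: uc_le0.
  by rewrite -acE leNgt ua.
(* If [u c = 0], the positive left derivative provides such a [k]; if [u c < 0], continuity does. *)
have [k] : exists k, [/\ 0 < k, k < c - a & u (c - k) < 0].
  suff H : \forall k \near 0^'+, u (c - k) < 0.
    near (0:R)^'+ => k; exists k; split; near: k => //.
      by apply: nbhs_right_gt.
    by apply: nbhs_right_lt; rewrite subr_gt0.
  move: uc_le0; rewrite le_eqVlt => /predU1P[uc0|uc0].
    have [|l l0 ul] := uderiv c _ uc0; first by rewrite ac; case/andP: cab.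
    by have := left_deriv_gt0 ul l0; rewrite uc0.
  have /nbhs_ballP[e /= e0 He] : \forall s \near c, `[a, b]%classic s -> u s < 0.
    exact: (cvgr_lt _ (ucont c cab)).
  near=> k; apply: He => /=.
    rewrite /ball/= opprB addrCA subrr addr0 gtr0_norm; near: k.
      exact: nbhs_right_lt.
    exact: nbhs_right_gt.
  have k0 : 0 < k by near: k; apply: nbhs_right_gt.
  have ka : k < c - a by near: k; apply: nbhs_right_lt; rewrite subr_gt0.
  case/andP: cab => _ cb; rewrite in_itv/=; apply/andP; split; lra.
move=> [k0 ka]; apply/negP; rewrite -leNgt ltW// before//; lra.
Unshelve. all: by end_near.
Qed.

(** * Solutions: continuity and one-sided derivatives *)

Definition solves (R : realType) (f : R * R -> R) (tau : R) (Tmax : \bar R)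
    (phi : R -> R) : Prop :=
  forall t, time_dom tau Tmax t ->
    has_deriv_within (time_dom tau Tmax) phi t (f (t, phi t)).

Lemma within_cvg_of_deriv (R : realType) (D : set R) (phi : R -> R) (t l : R) :
  has_deriv_within D phi t l ->
  phi s @[s --> within D (nbhs t)] --> phi t.
Proof.
move=> dphi.
have idt : s @[s --> within D t^'] --> t.
  by move=> U Ut; apply: filterS Ut => s Us _ _.
have : (phi s - phi t) / (s - t) * (s - t) + phi t @[s --> within D t^']
    --> phi t.
  rewrite -[X in _ --> X]add0r -(mulr0 l) -(subrr t).
  apply: cvgD; last exact: cvg_cst.
  by apply: cvgM => //; apply: cvgB => //; exact: cvg_cst.
(* The limit [H] is punctured at [t]; the point [s = t] is put back by hand. *)
move=> H U Ut; have /nbhs_ballP[e /= e0 He] := H _ Ut.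
apply/nbhs_ballP; exists e => //= s ts Ds.
have [->|st] := eqVneq s t; first exact: nbhs_singleton.
by have := He s ts st Ds; rewrite /preimage/= divfK ?subr_eq0// subrK.
Qed.

Lemma cvg_within_dnbhs_left (R : realType) (D : set R) (t : R) :
  (\forall k \near 0^'+, D (t - k)) -> t - k @[k --> 0^'+] --> within D t^'.
Proof.
move=> Dt U /nbhs_ballP[e /= e0 He].
suff : \forall k \near 0^'+, U (t - k) by [].
near=> k.
have k0 : 0 < k by near: k; apply: nbhs_right_gt.
apply: He => /=; last by near: k.
  by rewrite /ball/= opprB addrCA subrr addr0 gtr0_norm//; near: k;
     apply: nbhs_right_lt.
by rewrite -subr_eq0 addrAC subrr add0r oppr_eq0 gt_eqF.
Unshelve. all: by end_near.
Qed.

Lemma cvg_within_dnbhs_right (R : realType) (D : set R) (t : R) :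
  (\forall k \near 0^'+, D (t + k)) -> t + k @[k --> 0^'+] --> within D t^'.
Proof.
move=> Dt U /nbhs_ballP[e /= e0 He].
suff : \forall k \near 0^'+, U (t + k) by [].
near=> k.
have k0 : 0 < k by near: k; apply: nbhs_right_gt.
apply: He => /=; last by near: k.
  by rewrite /ball/= opprD addrA subrr add0r normrN gtr0_norm//; near: k;
     apply: nbhs_right_lt.
by rewrite -subr_eq0 addrAC subrr add0r gt_eqF.
Unshelve. all: by end_near.
Qed.

Lemma left_deriv_of_within (R : realType) (D : set R) (phi : R -> R)
    (t l : R) : (\forall k \near 0^'+, D (t - k)) ->
  has_deriv_within D phi t l -> left_deriv phi t l.
Proof.
move=> /cvg_within_dnbhs_left Dt dphi.
have H := cvg_comp _ _ Dt dphi; rewrite /left_deriv.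
apply: cvg_trans H; apply: near_eq_cvg; near=> k => /=.
by rewrite addrAC subrr add0r invrN mulrN -mulNr opprB.
Unshelve. all: by end_near.
Qed.

Lemma left_derivB (R : realType) (u v : R -> R) (t l m : R) :
  left_deriv u t l -> left_deriv v t m -> left_deriv (u \- v) t (l - m).
Proof.
move=> ul vm; rewrite /left_deriv; apply: cvg_trans (cvgB ul vm).
apply: near_eq_cvg.
near=> k.
rewrite -[LHS]/((u t - u (t - k)) / k - (v t - v (t - k)) / k) /=; ring.
Unshelve. all: by end_near.
Qed.

Lemma left_deriv_shift (R : realType) (u : R -> R) (p t l : R) :
  left_deriv u (t + p) l -> left_deriv (fun s => u (s + p)) t l.
Proof.
rewrite /left_deriv => ul; apply: cvg_trans ul; apply: near_eq_cvg.
by near=> k; rewrite addrAC.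
Unshelve. all: by end_near.
Qed.

Lemma solves_cvg (R : realType) (f : R * R -> R) (tau : R) (Tmax : \bar R)
    (phi : R -> R) (t : R) : solves f tau Tmax phi -> time_dom tau Tmax t ->
  phi s @[s --> within (time_dom tau Tmax) (nbhs t)] --> phi t.
Proof. by move=> sol Dt; apply: within_cvg_of_deriv (sol _ Dt). Qed.

Lemma solves_left_deriv (R : realType) (f : R * R -> R) (tau : R)
    (Tmax : \bar R) (phi : R -> R) (t : R) :
  solves f tau Tmax phi -> tau < t -> (t%:E < Tmax)%E ->
  left_deriv phi t (f (t, phi t)).
Proof.
move=> sol taut tT; apply: left_deriv_of_within; last first.
  by apply: sol; split => //; exact: ltW.
near=> k; split; last first.
  by apply: le_lt_trans tT; rewrite lee_fin gerBl; near: k; exact: nbhs_right_ge.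
by rewrite lerBrDl -lerBrDr; near: k; apply: nbhs_right_le; rewrite subr_gt0.
Unshelve. all: by end_near.
Qed.

Lemma solves_shift_cvg (R : realType) (f : R * R -> R) (tau : R)
    (Tmax : \bar R) (phi : R -> R) (p a b t : R) :
  solves f tau Tmax phi -> tau <= a + p -> ((b + p)%:E < Tmax)%E ->
  a <= t <= b -> phi (s + p) @[s --> within `[a, b] (nbhs t)] --> phi (t + p).
Proof.
move=> sol tauap bpT /andP[at_ tb].
have DP s : a <= s -> s <= b -> time_dom tau Tmax (s + p).
  move=> as_ sb; split; first by rewrite (le_trans tauap)// lerD2r.
  by apply: le_lt_trans bpT; rewrite lee_fin lerD2r.
have H : s + p @[s --> within `[a, b] (nbhs t)]
    --> within (time_dom tau Tmax) (nbhs (t + p)).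
  move=> U /nbhs_ballP[e /= e0 He]; apply/nbhs_ballP; exists e => //= s ts.
  rewrite /= in_itv/= => /andP[as_ sb]; apply: He; last exact: DP.
  by move: ts; rewrite /ball/= opprD addrACA subrr addr0.
exact: cvg_comp _ _ H (solves_cvg sol (DP _ at_ tb)).
Qed.

(** * Comparison of time-shifted solutions *)

(** The difference [psi (t + q) - phi (t + p)] is positive at [a], and wherever it vanishes its left
    derivative is the difference of the two slopes, positive by the contact hypothesis. Separate
    shifts [p] and [q] let one statement cover forward, backward and self-comparison. *)
Lemma shift_comparison (R : realType) (f g : R * R -> R) (tau : R)
    (Tphi Tpsi : \bar R) (phi psi : R -> R) (p q a b : R) :
  solves f tau Tphi phi -> solves g tau Tpsi psi ->
  tau <= a + p -> tau <= a + q ->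
  ((b + p)%:E < Tphi)%E -> ((b + q)%:E < Tpsi)%E ->
  phi (a + p) < psi (a + q) ->
  (forall t, a < t <= b -> phi (t + p) = psi (t + q) ->
    f (t + p, phi (t + p)) < g (t + q, psi (t + q))) ->
  forall t, a <= t <= b -> phi (t + p) < psi (t + q).
Proof.
move=> solf solg tauap tauaq bpT bqT aa touch t tab.
rewrite -subr_gt0.
pose u t := psi (t + q) - phi (t + p).
apply: (@gt0_of_left_deriv_gt0_at_zeros R u a b) => //.
- by rewrite /u subr_gt0.
- move=> s sab; apply: cvgB; first exact: (solves_shift_cvg solg).
  exact: (solves_shift_cvg solf).
- move=> s /andP[as_ sb] /eqP; rewrite subr_eq0 => /eqP/esym us.
  exists (g (s + q, psi (s + q)) - f (s + p, phi (s + p))).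
    by rewrite subr_gt0; apply: touch => //; rewrite as_.
  apply: (@left_derivB _ (fun s => psi (s + q)) (fun s => phi (s + p))).
    apply/left_deriv_shift/(solves_left_deriv solg).
      by apply: le_lt_trans tauaq _; rewrite ltrD2r.
    by apply: le_lt_trans bqT; rewrite lee_fin lerD2r.
  apply/left_deriv_shift/(solves_left_deriv solf).
    by apply: le_lt_trans tauap _; rewrite ltrD2r.
  by apply: le_lt_trans bpT; rewrite lee_fin lerD2r.
Qed.

Lemma near_right_lte (R : realType) (t : R) (Tmax : \bar R) :
  (t%:E < Tmax)%E -> \forall k \near 0^'+, ((t + k)%:E < Tmax)%E.
Proof.
move=> tT; apply/(nbhs_right0P t (fun s => s%:E < Tmax)%E)/cvg_within.
by apply: open_nbhs_nbhs; split => //; exact: open_ereal_lt.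
Qed.

(** Starts the comparison of a solution with its own shift: at [tau] the derivative relative to the
    domain is a right derivative, here positive. *)
Lemma solves_gt_init (R : realType) (f : R * R -> R) (tau : R)
    (Tmax : \bar R) (phi : R -> R) :
  solves f tau Tmax phi -> (tau%:E < Tmax)%E -> 0 < f (tau, phi tau) ->
  \forall k \near 0^'+, phi tau < phi (tau + k).
Proof.
move=> sol tauT ftau.
have Dtau : \forall k \near 0^'+, time_dom tau Tmax (tau + k).
  near=> k; split; last by near: k; exact: near_right_lte.
  by rewrite lerDl; near: k; exact: nbhs_right_ge.
have H := cvg_comp _ _ (cvg_within_dnbhs_right Dtau)
  (sol tau (conj (lexx tau) tauT)).
near=> k.
have k0 : 0 < k by near: k; apply: nbhs_right_gt.
have : 0 < (phi (tau + k) - phi tau) / (tau + k - tau).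
  by near: k; exact: (cvgr_gt _ H).
by rewrite addrAC subrr add0r pmulr_lgt0 ?invr_gt0// subr_gt0.
Unshelve. all: by end_near.
Qed.

(** For small [k] the path lies below its shift by [k] at [tau]; at a contact the shifted path has
    the larger slope, since [f] is evaluated at the same [x] but a later time. Larger increments are
    reached by chaining small ones. *)
Lemma solves_increasing (R : realType) (f : R * R -> R) (tau : R)
    (Tmax : \bar R) (phi : R -> R) :
  (forall x, {homo (fun t => f (t, x)) : s t / s < t}) ->
  solves f tau Tmax phi -> (tau%:E < Tmax)%E -> 0 < f (tau, phi tau) ->
  forall s t, tau <= s -> s < t -> (t%:E < Tmax)%E -> phi s < phi t.
Proof.
move=> finc sol tauT ftau s t taus st tT.
have [e e0 small] : exists2 e, 0 < e &
    forall k, 0 < k -> k < e -> phi tau < phi (tau + k).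
  have /nbhs_ballP[e /= e0 He] := solves_gt_init sol tauT ftau.
  exists e => // k k0 ke; apply: He => //=.
  by rewrite /ball/= sub0r normrN gtr0_norm.
have step k r : 0 < k -> k < e -> tau <= r -> ((r + k)%:E < Tmax)%E ->
    phi r < phi (r + k).
  move=> k0 ke taur rkT.
  rewrite -{1}(addr0 r).
  apply: (shift_comparison (a := tau) (b := r) sol sol); rewrite ?addr0//.
  - by rewrite lerDl ltW.
  - by apply: lt_trans rkT; rewrite lte_fin ltrDl.
  - exact: small.
  - by move=> c _; rewrite addr0 => <-; apply: finc; rewrite ltrDl.
  - by rewrite taur lexx.
(* This [n] makes [(t - s) / e < n.+1], so that [n.+1] equal steps from [s] to [t] are each shorter
   than [e]. *)
pose n := Num.truncn ((t - s) / e).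
pose h := (t - s) / n.+1%:R.
have h0 : 0 < h by rewrite divr_gt0// subr_gt0.
have he : h < e.
  rewrite /h ltr_pdivrMr// mulrC -ltr_pdivrMr//; exact: truncnS_gt.
have sh : s + h *+ n.+1 = t.
  by rewrite -mulr_natr divfK ?pnatr_eq0// addrC subrK.
have H i : (i <= n)%N -> phi s < phi (s + h *+ i.+1).
  elim: i => [_|i IH iltn].
    rewrite mulr1n; apply: step => //; apply: le_lt_trans tT.
    by rewrite lee_fin -sh lerD2l -{1}(mulr1n h) ler_pMn2l.
  apply: lt_trans (IH (ltnW iltn)) _; rewrite [in X in _ < X]mulrSr addrA.
  apply: step => //.
    by rewrite (le_trans taus)// lerDl mulrn_wge0// ltW.
  apply: le_lt_trans tT.
  by rewrite lee_fin -addrA -mulrSr -sh lerD2l ler_pMn2l.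
by rewrite -sh; exact: H.
Qed.

(** A perturbation smaller than [m] cannot undo the gain [m] that a time shift by [h] brings, so the
    shifts of [phi] remain strict barriers for [psi]. The [max] keeps the backward shift inside the
    domain of [phi]. *)
Lemma shift_sandwich (R : realType) (f g : R * R -> R) (tau xi : R)
    (Tphi Tpsi : \bar R) (phi psi : R -> R) (T X h m : R) :
  rhs_class f -> rhs_class g -> 0 < f (tau, xi) -> 0 < g (tau, xi) ->
  is_maximal_solution f tau xi Tphi phi ->
  is_maximal_solution g tau xi Tpsi psi ->
  tau < T -> 0 < h -> ((T + h)%:E < Tphi)%E -> phi (T + h) <= X ->
  (forall t x, tau <= t <= T -> xi <= x <= X ->
     f (t, x) + m <= f (t + h, x)) ->
  (forall t x, tau <= t <= T -> xi <= x <= X ->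
     `|f (t, x) - g (t, x)| < m) ->
  (T%:E < Tpsi)%E /\
  forall t, tau <= t <= T -> phi (Num.max tau (t - h)) <= psi t <= phi (t + h).
Proof.
move=> [_ finc _] [_ ginc _] f0 g0 [tauTphi _ phi0 solf _].
move=> [tauTpsi _ psi0 solg maxpsi] tauT h0 ThT phiX fm fg.
have phi_inc : forall s t, tau <= s -> s < t -> (t%:E < Tphi)%E -> phi s < phi t.
  by apply: (solves_increasing finc) => //; rewrite phi0.
have psi_inc : forall s t, tau <= s -> s < t -> (t%:E < Tpsi)%E -> psi s < psi t.
  by apply: (solves_increasing ginc) => //; rewrite psi0.
have phi_ge t : tau <= t -> (t%:E < Tphi)%E -> xi <= phi t.
  rewrite le_eqVlt => /predU1P[<-|taut] tTphi; first by rewrite phi0.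
  by rewrite -phi0 ltW// phi_inc.
have psi_ge t : tau <= t -> (t%:E < Tpsi)%E -> xi <= psi t.
  rewrite le_eqVlt => /predU1P[<-|taut] tTpsi; first by rewrite psi0.
  by rewrite -psi0 ltW// psi_inc.
have ltTphi t : t <= T + h -> (t%:E < Tphi)%E.
  by move=> tT; apply: le_lt_trans ThT; rewrite lee_fin.
have phi_le t : tau <= t -> t <= T + h -> phi t <= X.
  move=> taut; rewrite le_eqVlt => /predU1P[->//|tT].
  by rewrite (le_trans _ phiX)// ltW// phi_inc.
(* Existence of [psi] at [t] is assumed here, because [T < Tpsi] is itself deduced from this bound
   below. *)
have upper t : tau <= t <= T -> (t%:E < Tpsi)%E -> psi t < phi (t + h).
  move=> /andP[taut tT] tTpsi; rewrite -{1}(addr0 t).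
  apply: (shift_comparison (a := tau) (b := t) solg solf).
  - by rewrite addr0.
  - by rewrite lerDl ltW.
  - by rewrite addr0.
  - by apply: ltTphi; rewrite lerD2r.
  - rewrite addr0 psi0 -phi0 phi_inc ?ltrDl// ltTphi// lerD2r.
    exact: ltW.
  (* At a contact with common value [x]: [g (c, x) < f (c, x) + m <= f (c + h, x)]. The bound
     [phi (T + h) <= X] keeps [x] in the rectangle. *)
  - move=> c /andP[tauc ct]; rewrite addr0 => ->.
    have cT := le_trans ct tT.
    have xX : xi <= phi (c + h) <= X.
      rewrite phi_ge ?phi_le ?ltTphi ?lerD2r//; lra.
    have ctT : tau <= c <= T by rewrite cT ltW.
    move: (fm _ _ ctT xX) (fg _ _ ctT xX); rewrite ltr_norml => ? /andP[? ?].
    lra.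
  - by rewrite taut lexx.
have lower t : tau <= t <= T -> (t%:E < Tpsi)%E ->
    phi (Num.max tau (t - h)) <= psi t.
  (* Up to time [tau + h] the truncated shift is constantly [xi], a lower bound of [psi]; the
     comparison proper starts at [tau + h]. *)
  move=> /andP[taut tT] tTpsi; have [tht|tth] := leP (t - h) tau.
    by rewrite phi0 psi_ge.
  apply: ltW; rewrite -{2}(addr0 t).
  apply: (shift_comparison (a := tau + h) (b := t) solf solg).
  - by rewrite addrK.
  - by rewrite addr0 lerDl ltW.
  - by apply: ltTphi; lra.
  - by rewrite addr0.
  - rewrite addrK addr0 phi0 -psi0 psi_inc ?ltrDl//.
    by apply: lt_trans tTpsi; rewrite lte_fin -ltrBrDr.
  (* Here the gap is used at time [c - h] and the closeness at time [c]:
     [f (c - h, x) <= f (c, x) - m < g (c, x)]. *)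
  - move=> c /andP[tauc ct]; rewrite addr0 => <-.
    have xX : xi <= phi (c - h) <= X.
      by rewrite phi_ge ?phi_le ?ltTphi//; lra.
    have chT : tau <= c - h <= T by apply/andP; split; lra.
    have cT : tau <= c <= T by apply/andP; split; lra.
    move: (fm _ _ chT xX) (fg _ _ cT xX); rewrite subrK ltr_norml => ? /andP[? ?].
    lra.
  - by rewrite lexx andbT; lra.
(* If [Tpsi <= T], then [psi] stays in [[xi, X]] throughout its lifetime, so neither time nor values
   blow up, against maximality. *)
have TTpsi : (T%:E < Tpsi)%E.
  rewrite ltNge; apply/negP => TpsiT.
  suff : (maxe Tpsi (sup_norm (time_dom tau Tpsi) psi) < +oo)%E.
    by rewrite maxpsi ltxx.
  rewrite gt_max (le_lt_trans TpsiT (ltry _))/=.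
  apply: le_lt_trans (ltry (Num.max `|xi| `|X|)).
  apply: ge_ereal_sup => _ [t [taut tTpsi] <-]; rewrite lee_fin.
  have tT : t <= T by rewrite -lee_fin (le_trans (ltW tTpsi)).
  have psiX : psi t <= X.
    rewrite (le_trans (ltW (upper t _ _)))//; first by rewrite taut.
    by apply: phi_le; rewrite ?lerD2r//; lra.
  have := psi_ge t taut tTpsi; rewrite le_max.
  have [psi_pos|psi_neg] := leP 0 (psi t) => xipsi; apply/orP.
    by right; rewrite ger0_norm// (le_trans psiX)// ler_norm.
  by left; rewrite !ltr0_norm ?lerN2// (le_lt_trans xipsi).
split => // t ttT.
have tTpsi : (t%:E < Tpsi)%E.
  by apply: le_lt_trans TTpsi; rewrite lee_fin; case/andP: ttT.
by rewrite lower// ltW// upper.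
Qed.

(** * Limits and sup norms in the extended reals *)

(** Infinite values, as [path_dist] may take for early [n], are allowed: the bound with [e = 1]
    makes [u n] eventually finite. *)
Lemma cvge0_of_near_le (R : realType) (u : nat -> \bar R) :
  (forall n, 0 <= u n)%E ->
  (forall e : R, 0 < e -> \forall n \near \oo, (u n <= e%:E)%E) ->
  u n @[n --> \oo] --> 0%E.
Proof.
move=> u0 ue; apply/fine_cvgP; split.
  near=> n; rewrite ge0_fin_numE//; apply: le_lt_trans (ltry 1).
  by near: n; exact: ue.
apply/cvgrPdist_le => e e0; near=> n.
rewrite sub0r normrN ger0_norm ?fine_ge0//.
have une : (u n <= e%:E)%E by near: n; exact: ue.
by rewrite -lee_fin fineK// ge0_fin_numE// (le_lt_trans une)// ltry.
Unshelve. all: by end_near.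
Qed.

Lemma sup_norm_ge (R : realType) (S : Type) (A : set S) (g : S -> R) (s : S) :
  A s -> (`|g s|%:E <= sup_norm A g)%E.
Proof. by move=> As; apply: ereal_sup_ubound; exists s. Qed.

Lemma sup_norm_le (R : realType) (S : Type) (A : set S) (g : S -> R) (M : R) :
  (forall s, A s -> `|g s| <= M) -> (sup_norm A g <= M%:E)%E.
Proof. by move=> gM; apply: ge_ereal_sup => _ [s As <-]; rewrite lee_fin gM. Qed.

(** * Uniform estimates by compactness *)

(** The time increment of [f] is continuous and positive, so its minimum over the nonempty compact
    rectangle serves as [m]. Times [t + h] beyond [T] are harmless, [f] being continuous on the
    whole plane. *)
Lemma time_shift_gap (R : realType) (f : R * R -> R) (tau xi T X h : R) :
  rhs_class f -> tau <= T -> xi <= X -> 0 < h ->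
  exists2 m, 0 < m & forall t x, tau <= t <= T -> xi <= x <= X ->
    f (t, x) + m <= f (t + h, x).
Proof.
move=> [fcont finc _] tauT xiX h0.
pose g (z : R * R) := f (z.1 + h, z.2) - f z.
have gcont : continuous g.
  move=> z; apply: cvgB; last exact: fcont.
  apply: (@continuous_comp _ _ _ (fun z : R * R => (z.1 + h, z.2)) f).
    by apply: (cvg_pair (cvgD cvg_fst (cvg_cst _)) cvg_snd).
  exact: fcont.
have [|c _ cmin] := compact_EVT_min _
  (compact_setX (@segment_compact R tau T) (@segment_compact R xi X))
  (continuous_subspaceT gcont).
  by exists (tau, xi); split; rewrite /= in_itv/= lexx.
exists (g c).
  by rewrite subr_gt0; case: c {cmin} => t x; apply: finc; rewrite ltrDl.
move=> t x ttT xxX; rewrite addrC -lerBrDr.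
by apply: (cmin (t, x)); rewrite inE; split; rewrite /= in_itv.
Qed.

(** Uniform continuity near [[tau, T]], with room to the right of [T] because [T < Tmax]. *)
Lemma solves_uniform_modulus (R : realType) (f : R * R -> R) (tau : R)
    (Tmax : \bar R) (phi : R -> R) (T e : R) :
  solves f tau Tmax phi -> (T%:E < Tmax)%E -> 0 < e ->
  \forall h \near 0^'+, forall t, tau <= t <= T ->
    phi (t + h) - phi (Num.max tau (t - h)) < e.
Proof.
move=> sol TT e0.
(* In near-covering form, compactness reduces the claim to [s] near a fixed [t] and [h] near [0]
   jointly. *)
have /near_covering_withinP cov : near_covering `[tau, T].
  by apply/compact_near_coveringP; exact: segment_compact.
suff H : \forall h \near (0 : R)^'+, `[tau, T]%classic `<=`
    (fun t => phi (t + h) - phi (Num.max tau (t - h)) < e).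
  by apply: filterS H => h H t ttT; apply: H; rewrite /= in_itv/=.
apply: (cov R (at_right (0 : R))
  (fun h t => phi (t + h) - phi (Num.max tau (t - h)) < e)) => t.
rewrite /= in_itv/= => /andP[taut tT].
have Dt s : tau <= s -> (s%:E < Tmax)%E -> time_dom tau Tmax s by [].
have tTmax : (t%:E < Tmax)%E by apply: le_lt_trans TT; rewrite lee_fin.
have e20 : 0 < e / 2 by rewrite divr_gt0.
have /cvgrPdist_lt /(_ _ e20) := solves_cvg sol (Dt t taut tTmax).
move=> /nbhs_ballP[d /= d0 Hd].
have d20 : 0 < d / 2 by rewrite divr_gt0.
near=> s h => /=; rewrite in_itv/= => /andP[taus sT].
have h0 : 0 < h by near: h; exact: nbhs_right_gt.
have hd : h < d / 2 by near: h; exact: nbhs_right_lt.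
have ThT : ((T + h)%:E < Tmax)%E by near: h; exact: near_right_lte.
have ts : `|t - s| < d / 2 by near: s; exact: nbhsx_ballx.
(* Both shifted times are within [h < d / 2] of [s], hence within [d] of [t]; each value then costs
   [e / 2]. *)
have close r : tau <= r -> r <= T + h -> `|r - s| <= h -> `|phi t - phi r| < e / 2.
  move=> taur rT rs; apply: Hd.
    rewrite /ball/= (_ : t - r = (t - s) - (r - s)); last by ring.
    by rewrite (le_lt_trans (ler_normB _ _))//; lra.
  by split => //; apply: le_lt_trans ThT; rewrite lee_fin.
have c1 : `|phi t - phi (s + h)| < e / 2.
  apply: close; [lra|lra|].
  by rewrite addrAC subrr add0r gtr0_norm.
have c2 : `|phi t - phi (Num.max tau (s - h))| < e / 2.
  apply: close; rewrite ?le_max ?lexx// ?ge_max//.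
    by apply/andP; split; lra.
  by have [] := leP (s - h) tau => ?; rewrite ler0_norm; lra.
move: c1 c2; rewrite !ltr_norml => /andP[? ?] /andP[? ?]; lra.
Unshelve. all: by end_near.
Qed.

Theorem mainTheorem3 (R : realType) (tau xi : R)
    (f : nat -> R * R -> R)
    (fF : forall n, rhs_class (f n))
    (f_gt0 : forall n, 0 < f n (tau, xi))
    (Tmax : nat -> \bar R) (phi : nat -> R -> R)
    (phi_sol : forall n, is_maximal_solution (f n) tau xi (Tmax n) (phi n))
    (T : R) (tauT : tau < T) (TT0 : (T%:E < Tmax 0%N)%E)
    (X : R) (phiX : phi 0%N T < X) :
  sup_norm (`[tau, T] `*` `[xi, X]) (f 0%N \- f n) @[n --> \oo] --> 0%E ->
  path_dist tau T (phi 0%N) (Tmax n) (phi n) @[n --> \oo] --> 0%E.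
Proof.
move=> fcvg; have [tauT0 _ phi0 sol0 _] := phi_sol 0%N.
have [_ f0inc _] := fF 0%N.
have phi_inc : forall s t, tau <= s -> s < t -> (t%:E < Tmax 0%N)%E ->
    phi 0%N s < phi 0%N t.
  by apply: (solves_increasing f0inc) => //; rewrite phi0.
have xiX : xi <= X.
  by rewrite -phi0 ltW// (lt_trans _ phiX)// phi_inc.
have phi_max_le h t : 0 < h -> tau <= t -> t <= T ->
    phi 0%N (Num.max tau (t - h)) <= phi 0%N t.
  move=> h0 taut tT.
  have tTmax : (t%:E < Tmax 0%N)%E by apply: le_lt_trans TT0; rewrite lee_fin.
  have [tht|tth] := leP (t - h) tau; last first.
    by rewrite ltW// phi_inc//; [exact: ltW|rewrite gtrBl].
  move: taut; rewrite le_eqVlt => /predU1P[->//|taut].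
  by rewrite ltW// phi_inc.
apply: cvge0_of_near_le => [n|e e0].
  rewrite /path_dist; case: ifPn => // _.
  apply: le_trans (sup_norm_ge (s := T) _ _); first by rewrite lee_fin.
  by rewrite /= in_itv/= lexx andbT ltW.
have [h [h0 ThT phiThX mod_h]] : exists h, [/\ 0 < h,
    ((T + h)%:E < Tmax 0%N)%E, phi 0%N (T + h) <= X &
    forall t, tau <= t <= T -> phi 0%N (t + h) - phi 0%N (Num.max tau (t - h)) < e].
  near (0 : R)^'+ => h; exists h; split; near: h.
  - exact: nbhs_right_gt.
  - exact: near_right_lte.
  (* The modulus with tolerance [X - phi 0 T], taken at time [T], yields [phi 0 (T + h) <= X], since
     the backward-shifted value is at most [phi 0 T]. *)
  - have d0 : 0 < X - phi 0%N T by rewrite subr_gt0.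
    have H := solves_uniform_modulus sol0 TT0 d0.
    near=> h.
    have h0 : 0 < h by near: h; exact: nbhs_right_gt.
    have := phi_max_le h T h0 (ltW tauT) (lexx T).
    have mod_h : forall t, tau <= t <= T ->
        phi 0%N (t + h) - phi 0%N (Num.max tau (t - h)) < X - phi 0%N T.
      by near: h.
    have := mod_h T; rewrite lexx (ltW tauT) => /(_ isT); lra.
  - exact: (solves_uniform_modulus sol0).
(* The choices are nested: [h] depends on [e], then [m] on [h], and finally the threshold for [n] on
   [m]. *)
have [m m0 gap] := time_shift_gap (fF 0%N) (ltW tauT) xiX h0.
have near_m : \forall n \near \oo,
    (sup_norm (`[tau, T] `*` `[xi, X]) (f 0%N \- f n)%R < m%:E)%E.
  have m_nbhs : nbhs 0%E [set y : \bar R | (y < m%:E)%E].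
    by apply: open_ereal_lt'; rewrite lte_fin.
  exact: fcvg m_nbhs.
near=> n.
have supm : (sup_norm (`[tau, T] `*` `[xi, X]) (f 0%N \- f n)%R < m%:E)%E.
  by near: n.
have fm t x : tau <= t <= T -> xi <= x <= X -> `|f 0%N (t, x) - f n (t, x)| < m.
  move=> ttT xxX; rewrite -lte_fin; apply: le_lt_trans supm.
  by apply: (sup_norm_ge (s := (t, x)) (f 0%N \- f n)); split; rewrite /= in_itv.
have [TTn sandwich] := shift_sandwich (fF 0%N) (fF n) (f_gt0 0%N) (f_gt0 n)
  (phi_sol 0%N) (phi_sol n) tauT h0 ThT phiThX gap fm.
rewrite /path_dist TTn; apply: sup_norm_le => t; rewrite /= in_itv/= => ttT.
(* Both [phi 0 t] and [phi n t] lie between the two shifts of [phi 0], which differ by less than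
   [e]. *)
have /andP[lo hi] := sandwich t ttT; have mt := mod_h t ttT.
have /andP[taut tT] := ttT.
have : phi 0%N t < phi 0%N (t + h).
  apply: phi_inc => //; first by rewrite ltrDl.
  by apply: le_lt_trans ThT; rewrite lee_fin lerD2r.
have := phi_max_le h t h0 taut tT.
by rewrite ler_norml => ? ?; apply/andP; split; lra.
Unshelve. all: by end_near.
Qed.
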